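(* For every positive integer $m\ge 5$ there exists a $3$-dimensional polyhedral cone $K$ with $m$ extreme rays for which there is no $K$-primitive matrix $A$ such that the digraph $(\mathcal{E},\mathcal{P}(A,K))$ is isomorphic to $F_1$.
   Context: A proper cone $K$ in $\mathbb{R}^n$ is a closed convex cone that is pointed ($K\cap(-K)=\{0\}$) and has nonempty interior. A face of $K$ is a subcone $F\subseteq K$ such that $y\in F$ whenever $x\in F$ and $y,x-y\in K$. For $x\in K$, $\Phi(x)$ is the smallest face of $K$ containing $x$. A nonzero $x\in K$ is an extreme vector if $\Phi(x)=\{\lambda x:\lambda\ge0\}$, which is then an extreme ray. A polyhedral cone is a proper cone with finitely many extreme rays. $\pi(K)$ is the set of real matrices $A$ with $AK\subseteq K$. $A\in\pi(K)$ is $K$-primitive if $A^p(K\setminus\{0\})\subseteq\operatorname{int}K$ for some positive integer $p$. For $A\in\pi(K)$, $(\mathcal{E},\mathcal{P}(A,K))$ is the digraph whose vertices are the extreme rays of $K$, with an arc $(\Phi(x),\Phi(y))$ whenever $\Phi(y)\subseteq\Phi(Ax)$. $F_1$ is the digraph on vertices $x_1,\ldots,x_m$ with arcs $x_i\to x_{i+1}$ ($1\le i\le m-1$), $x_m\to x_1$ and $x_m\to x_2$. *)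

(* Defs.v *)
From HB Require Import structures.
From mathcomp Require Import all_boot all_order all_algebra.
From mathcomp Require Import boolp classical_sets functions cardinality reals.
From mathcomp Require Import topology normedtype.

Set Implicit Arguments.
Unset Strict Implicit.
Unset Printing Implicit Defensive.

Import Order.TTheory GRing.Theory Num.Theory.
Import numFieldNormedType.Exports.

Local Open Scope classical_set_scope.
Local Open Scope ring_scope.

Section Cones.
Context {R : realType} {n : nat}.
Implicit Types (K F : set 'cV[R]_n) (x y : 'cV[R]_n) (A : 'M[R]_n).

Definition convex_cone K : Prop :=
  K 0 /\ forall (a b : R) x y, 0 <= a -> 0 <= b -> K x -> K y ->
    K (a *: x + b *: y).

Definition pointed K : Prop := K `&` [set - x | x in K] = [set 0].

Definition proper_cone K : Prop :=
  [/\ convex_cone K, closed K, pointed K & K° !=set0].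

Definition face K F : Prop :=
  [/\ convex_cone F, F `<=` K &
    forall x y, F x -> K y -> K (x - y) -> F y].

(* Faces are stable under intersection, so this is the smallest face of K
   containing x when x lies in K. *)
Definition Phi K x : set 'cV[R]_n :=
  \bigcap_(F in [set F | face K F /\ F x]) F.

Definition extreme_vector K x : Prop :=
  [/\ K x, x != 0 & Phi K x = [set l *: x | l in [set l : R | 0 <= l]]].

Definition extreme_rays K : set (set 'cV[R]_n) :=
  [set Phi K x | x in extreme_vector K].

Definition polyhedral_cone K : Prop :=
  proper_cone K /\ finite_set (extreme_rays K).

Definition cone_preserving K A : Prop := forall x, K x -> K (A *m x).

Definition K_primitive K A : Prop :=
  cone_preserving K A /\
  exists2 p : nat, (0 < p)%N & forall x, K x -> x != 0 -> K° (A ^+ p *m x).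

End Cones.

Record digraph := Digraph { vertex : Type; arc : vertex -> vertex -> Prop }.

Definition digraph_isomorphic (G H : digraph) : Prop :=
  exists2 f : vertex G -> vertex H, bijective f &
    forall u v, arc u v <-> arc (f u) (f v).

Definition ray_digraph {R : realType} {n : nat}
    (A : 'M[R]_n) (K : set 'cV[R]_n) : digraph :=
  @Digraph (set_type (extreme_rays K)) (fun E1 E2 =>
    exists x y, [/\ extreme_vector K x, extreme_vector K y,
      val E1 = Phi K x, val E2 = Phi K y & Phi K y `<=` Phi K (A *m x)]).

(* The ordinal i stands for the vertex x_(i+1). *)
Definition F1 (m : nat) : digraph :=
  @Digraph 'I_m (fun i j =>
    [\/ (j = i.+1 :> nat)%N, i.+1 = m /\ j = 0%N :> nat |
        i.+1 = m /\ j = 1%N :> nat]).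

(* Main.v *)
Require Import Defs.
From mathcomp Require Import all_boot all_order all_algebra.
From mathcomp Require Import boolp classical_sets functions cardinality reals.
From mathcomp Require Import topology normedtype.
From mathcomp Require Import ring lra.
Import Order.TTheory GRing.Theory Num.Theory.
Import numFieldNormedType.Exports.
Local Open Scope classical_set_scope.
Local Open Scope ring_scope.

(* K is the cone over points (1, t_i, t_i^2) of a conic.  If the digraph of A is
   F1, then in a suitable labelling A maps the ray of x_i to that of x_(i+1) for
   i < m, and A x_m lies strictly inside the face spanned by x_1 and x_2.  Let Q be
   the quadratic form of the conic.  On the conic, Q o A is a polynomial of degree
   at most 4 in t vanishing at t_1, ..., t_(m-1); for m >= 6 it is therefore zero,
   whereas Q (A x_m) <> 0 because a proper chord of a conic misses the conic.  For
   m = 5 comparing determinants instead gives one polynomial relation between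
   t_1, ..., t_5, which no ordering of 0, 1, 4, 9, 16 satisfies. *)

(** * The cone over finitely many points of a conic, and its supporting functionals *)

Section ConicCone.
Set Implicit Arguments.
Unset Strict Implicit.
Context {R : realType}.
Implicit Types (s c : R) (v : 'cV[R]_3).

Definition conic_pt s : 'cV[R]_3 := \col_k s ^+ k.

(** At [conic_pt p] this functional takes the value [(p - s) ^+ 2], so its kernel is the plane
    tangent to the quadratic cone along the ray of [conic_pt s]. *)
Definition tangent s v : R := v ord_max 0 - 2 * s * v 1 0 + s ^+ 2 * v 0 0.

Lemma conic_ptE s : ((conic_pt s 0 0 = 1) * (conic_pt s 1 0 = s)
  * (conic_pt s ord_max 0 = s ^+ 2))%type.
Proof. by rewrite !mxE expr0 expr1. Qed.

Lemma col3P (u v : 'cV[R]_3) :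
  u 0 0 = v 0 0 -> u 1 0 = v 1 0 -> u ord_max 0 = v ord_max 0 -> u = v.
Proof.
move=> e0 e1 e2; apply/colP => -[[|[|[|//]]] lt3].
- by rewrite (_ : Ordinal lt3 = 0) //; apply: val_inj.
- by rewrite (_ : Ordinal lt3 = 1) //; apply: val_inj.
- by rewrite (_ : Ordinal lt3 = ord_max) //; apply: val_inj.
Qed.

Lemma conic_pt_neq0 s : conic_pt s != 0.
Proof.
apply/eqP => /(congr1 (fun v => v 0 0)); rewrite conic_ptE mxE => /eqP.
by rewrite oner_eq0.
Qed.

Lemma conic_pt_ray_inj s s' c : conic_pt s = c *: conic_pt s' -> s = s' /\ c = 1.
Proof.
move=> e; have := congr1 (fun v => v 0 0) e; have := congr1 (fun v => v 1 0) e.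
by rewrite !mxE !expr1 !expr0 mulr1 => -> <-; rewrite mul1r.
Qed.

Context (t : nat -> R) (m : nat).
Hypothesis t_inj : injective t.

Definition conic_cone : set 'cV[R]_3 :=
  [set v | exists2 a : 'I_m -> R, (forall i, 0 <= a i) &
    v = \sum_i a i *: conic_pt (t i)].

Lemma conic_cone_lin (a b : R) (u v : 'cV[R]_3) : 0 <= a -> 0 <= b ->
  conic_cone u -> conic_cone v -> conic_cone (a *: u + b *: v).
Proof.
move=> a0 b0 [f f0 ->] [g g0 ->].
exists (fun i => a * f i + b * g i).
  by move=> i; rewrite addr_ge0 ?mulr_ge0.
rewrite !scaler_sumr -big_split /=; apply: eq_bigr => i _.
by rewrite scalerDl !scalerA.
Qed.

Lemma conic_cone0 : conic_cone 0.
Proof. by exists (fun=> 0) => //; rewrite big1 // => i _; rewrite scale0r. Qed.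

Lemma conic_cone_convex : convex_cone conic_cone.
Proof.
by split=> [|a b u v a0 b0]; [exact: conic_cone0 | exact: conic_cone_lin].
Qed.

Lemma conic_coneD u v : conic_cone u -> conic_cone v -> conic_cone (u + v).
Proof.
by move=> Ku Kv; rewrite -[u]scale1r -[v]scale1r; apply: conic_cone_lin.
Qed.

Lemma conic_coneZ c v : 0 <= c -> conic_cone v -> conic_cone (c *: v).
Proof.
by move=> c0 Kv; rewrite -[_ *: v]addr0 -[0](scale0r 0); apply: conic_cone_lin => //;
  exact: conic_cone0.
Qed.

Lemma conic_cone_sum (P : pred 'I_m) (f : 'I_m -> 'cV[R]_3) :
  (forall i, P i -> conic_cone (f i)) -> conic_cone (\sum_(i | P i) f i).
Proof.
by move=> Kf; apply: big_ind => //; [exact: conic_cone0 | exact: conic_coneD].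
Qed.

Lemma conic_cone_pt i : (i < m)%N -> conic_cone (conic_pt (t i)).
Proof.
move=> im; exists (fun j => (j == Ordinal im)%:R); first by move=> j; rewrite ler0n.
rewrite (bigD1 (Ordinal im)) //= eqxx scale1r big1 ?addr0 // => j /negbTE ->.
by rewrite scale0r.
Qed.

Lemma sum_coord (a : 'I_m -> R) k :
  (\sum_i a i *: conic_pt (t i)) k 0 = \sum_i a i * t i ^+ k.
Proof. by rewrite summxE; apply: eq_bigr => i _; rewrite !mxE. Qed.

Lemma tangent_sum s (a : 'I_m -> R) :
  tangent s (\sum_i a i *: conic_pt (t i)) = \sum_i a i * (t i - s) ^+ 2.
Proof.
rewrite /tangent !sum_coord !mulr_sumr -sumrB -big_split /=.
by apply: eq_bigr => i _; rewrite expr1 expr0; ring.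
Qed.

Lemma tangentB s u v : tangent s (u - v) = tangent s u - tangent s v.
Proof. by rewrite /tangent !mxE; ring. Qed.

Lemma tangentZ s c v : tangent s (c *: v) = c * tangent s v.
Proof. by rewrite /tangent !mxE; ring. Qed.

Lemma tangent_pt s : tangent s (conic_pt s) = 0.
Proof. by rewrite /tangent !conic_ptE; ring. Qed.

Lemma tangent_ge0 s v : conic_cone v -> 0 <= tangent s v.
Proof.
move=> [a a0 ->]; rewrite tangent_sum; apply: sumr_ge0 => i _.
by rewrite mulr_ge0 ?sqr_ge0.
Qed.

Lemma conic_cone_hd_ge0 v : conic_cone v -> 0 <= v 0 0.
Proof.
move=> [a a0 ->]; rewrite sum_coord; apply: sumr_ge0 => i _.
by rewrite expr0 mulr1.
Qed.

(** Every generator has height 1, so the height of [v] is the sum of its nonnegative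
    coefficients. *)
Lemma conic_cone_hd_eq0 v : conic_cone v -> v 0 0 = 0 -> v = 0.
Proof.
move=> [a a0 ->]; rewrite sum_coord => /eqP; rewrite psumr_eq0; last first.
  by move=> i _; rewrite expr0 mulr1.
move=> /allP a_0; apply: big1 => i _.
by have /= := a_0 i (mem_index_enum _); rewrite expr0 mulr1 => /eqP ->; rewrite scale0r.
Qed.

Lemma conic_cone_pointed : pointed conic_cone.
Proof.
apply/seteqP; split=> [v [Kv [u Ku uv]]|_ ->]; last first.
  by split; [|exists 0; rewrite ?oppr0 //]; exact: conic_cone0.
apply: conic_cone_hd_eq0 => //; apply/eqP; rewrite eq_le conic_cone_hd_ge0 // andbT.
by rewrite -uv mxE oppr_le0 conic_cone_hd_ge0.
Qed.

(* The tangent to the conic at [t i] supports the cone exactly along the ray. *)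
Lemma tangent_eq0 i v : (i < m)%N -> conic_cone v -> tangent (t i) v = 0 ->
  exists2 c, 0 <= c & v = c *: conic_pt (t i).
Proof.
move=> im [a a0 ->]; rewrite tangent_sum => /eqP; rewrite psumr_eq0; last first.
  by move=> j _; rewrite mulr_ge0 ?sqr_ge0.
move=> /allP a_0; exists (a (Ordinal im)) => //.
rewrite (bigD1 (Ordinal im)) //= big1 ?addr0 // => j ji.
have /= := a_0 j (mem_index_enum _); rewrite mulf_eq0 sqrf_eq0 subr_eq0.
case/orP => [/eqP ->|/eqP /t_inj /= eji]; first by rewrite scale0r.
by case/eqP: ji; apply: val_inj.
Qed.

(** * Faces and extreme rays of the cone *)

Definition ray v : set 'cV[R]_3 := [set c *: v | c in [set c : R | 0 <= c]].

(** If [v] and [c *: conic_pt (t i) - v] lie in the cone, [tangent (t i)] is nonnegative on both and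
    their sum is on its kernel. Hence it vanishes at [v], and [tangent_eq0] applies. *)
Lemma ray_face i : (i < m)%N -> face conic_cone (ray (conic_pt (t i))).
Proof.
move=> im; split.
- split=> [|a b _ _ a0 b0 [c c0 <-] [d d0 <-]]; first by exists 0; rewrite ?scale0r /=.
  by exists (a * c + b * d); rewrite /= ?addr_ge0 ?mulr_ge0 // scalerDl !scalerA.
- by move=> _ [c c0 <-]; apply: conic_coneZ => //; exact: conic_cone_pt.
- move=> _ v [c c0 <-] Kv Kcv.
  have tv : tangent (t i) v = 0.
    apply/eqP; rewrite eq_le (tangent_ge0 _ Kv) andbT.
    have := tangent_ge0 (t i) Kcv.
    by rewrite tangentB tangentZ tangent_pt mulr0 sub0r oppr_ge0.
  by have [d d0 ->] := tangent_eq0 im Kv tv; exists d.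
Qed.

Lemma Phi_self v : Phi conic_cone v v.
Proof. by move=> F []. Qed.

Lemma PhiZ c v : 0 < c -> Phi conic_cone (c *: v) = Phi conic_cone v.
Proof.
move=> c0; have FZ F d u : 0 < d -> face conic_cone F -> F u -> F (d *: u).
  move=> d0 [[F0 Fc] _ _] Fu; rewrite -[_ *: u]addr0 -[0](scale0r 0).
  by apply: Fc => //; exact: ltW.
apply/seteqP; split=> w Pw F [fF Fv]; apply: Pw; split=> //; first exact: FZ.
by rewrite -[v](scalerK (lt0r_neq0 c0)); apply: FZ => //; rewrite invr_gt0.
Qed.

Lemma Phi_pt i : (i < m)%N -> Phi conic_cone (conic_pt (t i)) = ray (conic_pt (t i)).
Proof.
move=> im; apply/seteqP; split=> [w|_ [c c0 <-] F [[[F0 Fc] _ _] Fx]].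
  by apply; split; [exact: ray_face | exists 1; rewrite ?scale1r //=].
by rewrite -[_ *: _]addr0 -[0](scale0r 0); apply: Fc.
Qed.

Lemma extreme_pt i : (i < m)%N -> extreme_vector conic_cone (conic_pt (t i)).
Proof.
by move=> im; split; [exact: conic_cone_pt | exact: conic_pt_neq0 | exact: Phi_pt].
Qed.

(** The remaining terms of the sum stay in the cone, so every face through the sum contains the
    [j]-th term, and then its positive multiples. *)
Lemma Phi_summand (a : 'I_m -> R) j : (forall i, 0 <= a i) -> 0 < a j ->
  Phi conic_cone (\sum_i a i *: conic_pt (t i)) (conic_pt (t j)).
Proof.
move=> a0 aj; rewrite -(scalerK (lt0r_neq0 aj) (conic_pt (t j))).
move=> F [[[F0 Fc] FK Ff] Fx].
rewrite -[_ *: (_ *: _)]addr0 -[0](scale0r 0).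
apply: Fc => //; first by rewrite invr_ge0.
apply: Ff Fx _ _; first by apply: conic_coneZ => //; exact: conic_cone_pt.
rewrite (bigD1 j) //= addrAC subrr add0r; apply: conic_cone_sum => i _.
by apply: conic_coneZ => //; exact: conic_cone_pt.
Qed.

Lemma Phi_sub u v : Phi conic_cone v u -> Phi conic_cone u `<=` Phi conic_cone v.
Proof. by move=> vu w uw F [fF Fv]; apply: uw; split=> //; apply: vu. Qed.

(** A nonzero [v] has a positive coefficient; by [Phi_summand] the corresponding conic point lies in
    [Phi v], which is the ray of [v]. *)
Lemma extreme_vectorP v : extreme_vector conic_cone v ->
  exists2 i, (i < m)%N & exists2 c, 0 < c & v = c *: conic_pt (t i).
Proof.
move=> [[a a0 va] v0 Pv].
have [j aj] : exists j, 0 < a j.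
  apply/not_existsP => aN; case/eqP: v0; rewrite va big1 // => i _.
  have := aN i; rewrite lt_neqAle a0 andbT => /negP; rewrite negbK => /eqP <-.
  by rewrite scale0r.
exists j => //; have := Phi_summand a0 aj; rewrite -va Pv => -[c /= c0 cv].
have c_neq0 : c != 0.
  by apply/eqP => c_0; move: cv; rewrite c_0 scale0r => /esym/eqP;
    rewrite (negbTE (conic_pt_neq0 _)).
exists c^-1; first by rewrite invr_gt0 lt_neqAle eq_sym c_neq0.
by rewrite -cv scalerK.
Qed.

Lemma extreme_raysE :
  extreme_rays conic_cone = (fun i => Phi conic_cone (conic_pt (t i))) @` `I_m.
Proof.
apply/seteqP; split=> [_ [v /extreme_vectorP [i im [c c0 ->]] <-]|_ [i im <-]].
  by exists i => //; rewrite PhiZ.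
by exists (conic_pt (t i)) => //; exact: extreme_pt.
Qed.

(** The ray of [conic_pt (t i)] is a face containing [c *: conic_pt (t i)], even for [c = 0]. That
    degenerate case serves later to show that coefficients are nonzero. *)
Lemma Phi_pt_sub i j c : (i < m)%N -> (j < m)%N -> 0 <= c ->
  Phi conic_cone (conic_pt (t j)) `<=` Phi conic_cone (c *: conic_pt (t i)) -> j = i.
Proof.
move=> im jm c0 ji; have fi := ray_face im.
have /(_ _) [|d _ /esym/conic_pt_ray_inj [/t_inj]//] :=
  ji _ (Phi_self (v := conic_pt (t j))) (ray (conic_pt (t i))).
by split=> //; exists c.
Qed.

Lemma extreme_rays_card : (extreme_rays conic_cone #= `I_m)%card.
Proof.
rewrite extreme_raysE; apply: inj_card_eq => i j; rewrite !inE /= => im jm eij.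
by apply: (@Phi_pt_sub j i 1) => //; rewrite scale1r eij.
Qed.

(** * Topology of the cone: nonempty interior and closedness *)

Lemma conic_cone_interior : (3 <= m)%N -> conic_cone° !=set0.
Proof.
(* Reading the entries of [v] as the values of 1, X, X^2, this is the Lagrange basis polynomial at
   [t p] for the nodes [t p], [t q], [t r]. It gives the coordinates of [v] in the basis of three
   conic points. *)
move=> m3; pose l (p q r : nat) (v : 'cV[R]_3) : R :=
  (v ord_max 0 - (t q + t r) * v 1 0 + t q * t r * v 0 0) / ((t p - t q) * (t p - t r)).
have tN i j : i != j -> t i - t j != 0.
  by move=> ij; rewrite subr_eq0; apply: contraNneq ij => /t_inj ->.
have lo p q r : open [set v | 0 < l p q r v].
  apply: (@open_comp _ _ (l p q r) [set x | 0 < x]) => [v _|]; last exact: open_gt.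
  have ck k : {for v, continuous (fun v : 'cV[R]_3 => v k 0)} by exact: coord_continuous.
  apply: (@cvgMr_tmp _ _ (nbhs v) _
    (fun v => v ord_max 0 - (t q + t r) * v 1 0 + t q * t r * v 0 0)).
  apply: cvgD; first apply: cvgB; first exact: ck.
    by apply: cvgMl_tmp; exact: ck.
  by apply: cvgMl_tmp; exact: ck.
pose U := [set v | 0 < l 0%N 1%N 2%N v] `&`
  ([set v | 0 < l 1%N 0%N 2%N v] `&` [set v | 0 < l 2%N 0%N 1%N v]).
(* All three Lagrange coordinates of this vector equal 1. *)
exists (conic_pt (t 0%N) + (conic_pt (t 1%N) + conic_pt (t 2%N))).
have n01 := tN 0%N 1%N isT; have n02 := tN 0%N 2%N isT; have n12 := tN 1%N 2%N isT.
have n10 := tN 1%N 0%N isT; have n20 := tN 2%N 0%N isT; have n21 := tN 2%N 1%N isT.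
suff UK : U `<=` conic_cone.
  apply: (filterS UK); apply: open_nbhs_nbhs; split.
    by do 2![apply: openI => //].
  rewrite /U /l; split; [|split]; rewrite /= !mxE ?expr0 ?expr1 /=;
    by rewrite [ltRHS](_ : _ = 1) ?ltr01 //; field; rewrite ?n01 ?n02 ?n10 ?n12 ?n20 ?n21.
move=> v [/= l0 [l1 l2]].
have -> : v = l 0%N 1%N 2%N v *: conic_pt (t 0%N) +
    (l 1%N 0%N 2%N v *: conic_pt (t 1%N) + l 2%N 0%N 1%N v *: conic_pt (t 2%N)).
  by apply: col3P; rewrite !mxE /l ?expr0 ?expr1 /=; field;
    rewrite ?n01 ?n02 ?n10 ?n12 ?n20 ?n21.
do !apply: conic_coneD; apply: conic_coneZ; try exact: ltW.
all: apply: conic_cone_pt; exact: leq_trans m3.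
Qed.

(* Bounding the height [v 0 0] bounds all coefficients, so locally the cone is
   the continuous image of a compact box. *)
Lemma conic_cone_closed : closed conic_cone.
Proof.
(* The extra 1 leaves a neighbourhood of [p] where the height stays below [N]. *)
move=> p clp; pose N := p 0 0 + 1.
pose B := [set a : 'rV[R]_m | forall i, [set` `[0, N]] (a ord0 i)].
pose f (a : 'rV[R]_m) : 'cV[R]_3 := \sum_i a ord0 i *: conic_pt (t i).
have cB : compact B by apply: (@rV_compact R^o m (fun=> [set` `[0, N]])) => i;
  exact: segment_compact.
have cf : continuous f.
  apply: continuous_big => [|i _ a]; first exact: add_continuous.
  by apply: (@cvgZr_tmp _ _ _ (nbhs a) _ (fun a : 'rV[R]_m => a ord0 i));
    exact: coord_continuous.
have cfB : closed (f @` B).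
  apply: compact_closed; first exact: norm_hausdorff.
  by apply: continuous_compact => //; exact: continuous_subspaceT.
suff [a Ba <-] : (f @` B) p.
  by exists (a ord0) => // i; have := Ba i; rewrite /= in_itv /= => /andP [].
apply: cfB => U Up.
have : nbhs p (U `&` [set v | v 0 0 < N]).
  apply: filterI => //; apply: open_nbhs_nbhs; split; last by rewrite /= /N ltrDl.
  apply: (@open_comp _ _ (fun v : 'cV[R]_3 => v 0 0) [set x | x < N]) => [v _|].
    exact: coord_continuous.
  exact: open_lt.
move=> /clp [v [[a a0 va] [Uv vN]]]; exists v; split=> //.
exists (\row_i a i); last by rewrite va /f; apply: eq_bigr => i _; rewrite mxE.
move=> i /=; rewrite in_itv /= mxE a0 /= ltW //; apply: le_lt_trans vN.
rewrite va sum_coord (bigD1 i) //= expr0 mulr1 lerDl; apply: sumr_ge0 => j _.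
by rewrite expr0 mulr1.
Qed.

Lemma conic_cone_polyhedral : (3 <= m)%N -> polyhedral_cone conic_cone.
Proof.
move=> m3; split; last by rewrite extreme_raysE; apply: finite_image; exact: finite_II.
split; [exact: conic_cone_convex | exact: conic_cone_closed
  | exact: conic_cone_pointed | exact: conic_cone_interior].
Qed.

End ConicCone.

(** * Two obstructions: the quadratic form of the conic, and a determinant relation for five
    points *)

Section ConicForm.
Set Implicit Arguments.
Unset Strict Implicit.
Context {R : realType}.
Implicit Types (A : 'M[R]_3) (u v w : 'cV[R]_3).

Lemma mulmx3E A v k : (A *m v) k 0 =
  A k 0 * v 0 0 + A k 1 * v 1 0 + A k ord_max * v ord_max 0.
Proof.
rewrite mxE !big_ord_recl big_ord0 addr0 addrA.
by congr (_ + _ * _ + _ * _); congr (_ _ _); apply: val_inj.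
Qed.

Definition conic_form v : R := v 0 0 * v ord_max 0 - v 1 0 ^+ 2.

(** The form vanishes at the end points of a chord and nowhere strictly between them. The case
    [b = 0] covers multiples of a single conic point. *)
Lemma conic_form_chord a b (p q : R) :
  conic_form (a *: conic_pt p + b *: conic_pt q) = a * b * (p - q) ^+ 2.
Proof. by rewrite /conic_form !mxE !expr0 !expr1; ring. Qed.

(* Along the conic, the pulled-back form is a polynomial of degree at most 4 in
   the parameter, so five zeros force it to vanish on the whole conic. *)
Lemma conic_form_mulmx_eq0 A (rs : seq R) (s : R) : uniq rs -> (4 < size rs)%N ->
  (forall r, r \in rs -> conic_form (A *m conic_pt r) = 0) ->
  conic_form (A *m conic_pt s) = 0.
Proof.
move=> rs_uniq rs5 rs0.
pose a i := A 0 i; pose b i := A 1 i; pose c i := A ord_max i.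
pose z : 'I_3 := 0; pose o : 'I_3 := 1; pose w : 'I_3 := ord_max.
(* [Poly] bounds the size by the length 5 of the list, whether or not the leading entry vanishes. *)
pose q := Poly [:: a z * c z - b z ^+ 2;
  a z * c o + a o * c z - 2 * b z * b o;
  a z * c w + a o * c o + a w * c z - 2 * b z * b w - b o ^+ 2;
  a o * c w + a w * c o - 2 * b o * b w; a w * c w - b w ^+ 2].
have qE x : q.[x] = conic_form (A *m conic_pt x).
  rewrite /q horner_Poly /= /conic_form !mulmx3E !conic_ptE /a /b /c /z /o /w.
  by ring.
have [q0|q_neq0] := eqVneq q 0; first by rewrite -qE q0 horner0.
have rq : all (root q) rs by apply/allP => r /rs0; rewrite -qE => /eqP.
have := leq_trans (max_poly_roots q_neq0 rq rs_uniq) (size_Poly _).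
by rewrite ltnS leqNgt rs5.
Qed.

(** The determinant with columns [u], [v], [w], expanded so that [ring] and [lra] can work on it. *)
Definition det3 u v w : R :=
  u 0 0 * (v 1 0 * w ord_max 0 - w 1 0 * v ord_max 0)
  - v 0 0 * (u 1 0 * w ord_max 0 - w 1 0 * u ord_max 0)
  + w 0 0 * (u 1 0 * v ord_max 0 - v 1 0 * u ord_max 0).

Lemma det3_mulmx A u v w :
  det3 (A *m u) (A *m v) (A *m w)
  = det3 (col 0 A) (col 1 A) (col ord_max A) * det3 u v w.
Proof.
rewrite /det3 !mulmx3E; rewrite !mxE; ring.
Qed.

(* Eliminates A, a and c from the images of the determinants [0 1 4], [0 4 2],
   [0 2 3], [0 1 3]; b drops out of the
   first two because A x_0 is proportional to x_1. *)
Lemma pentagon_condition A (r : nat -> R) (c : nat -> R) (a b : R) :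
  {in gtn 5 &, injective r} ->
  (forall i, (i < 4)%N -> A *m conic_pt (r i) = c i *: conic_pt (r i.+1)) ->
  (forall i, (i < 4)%N -> c i != 0) -> a != 0 ->
  A *m conic_pt (r 4) = a *: conic_pt (r 0) + b *: conic_pt (r 1) ->
  (r 2 - r 0) * (r 3 - r 1) * (r 3 - r 4) = (r 4 - r 1) * (r 3 - r 0) * (r 2 - r 3).
Proof.
move=> r_inj Ar c_neq0 a0 Ar4.
have rN i j : (i < 5)%N -> (j < 5)%N -> i != j -> r i - r j != 0.
  by move=> i5 j5; apply: contraNneq => /eqP; rewrite subr_eq0 => /eqP /r_inj ->.
have d u v w := det3_mulmx A u v w.
move: (d (conic_pt (r 0)) (conic_pt (r 1)) (conic_pt (r 4))).
move: (d (conic_pt (r 0)) (conic_pt (r 4)) (conic_pt (r 2))).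
move: (d (conic_pt (r 0)) (conic_pt (r 2)) (conic_pt (r 3))).
move: (d (conic_pt (r 0)) (conic_pt (r 1)) (conic_pt (r 3))).
set D := det3 (col 0 A) _ _; rewrite Ar4 !Ar // /det3 !mxE ?expr0 ?expr1 /=.
set x0 := r 0; set x1 := r 1; set x2 := r 2; set x3 := r 3; set x4 := r 4.
(* The Vandermonde determinant of the conic points with parameters [p], [q], [s]. *)
pose V (p q s : R) := (q - p) * (s - p) * (s - q).
move=> e4 e3 e2 e1.
have {}e1 : c 0 * c 1 * a * V x1 x2 x0 = D * V x0 x1 x4.
  by rewrite /V; lra.
have {}e2 : c 0 * c 2 * a * V x1 x0 x3 = D * V x0 x4 x2.
  by rewrite /V; lra.
have {}e3 : c 0 * c 2 * c 3 * V x1 x3 x4 = D * V x0 x2 x3.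
  by rewrite /V; lra.
have {}e4 : c 0 * c 1 * c 3 * V x1 x2 x4 = D * V x0 x1 x3.
  by rewrite /V; lra.
have D0 : D != 0.
  apply/eqP => D0; move/eqP: e1; rewrite D0 mul0r /V !mulf_eq0.
  by rewrite !(negbTE (c_neq0 _ _)) // (negbTE a0) !(negbTE (rN _ _ _ _ _)).
(* The scalars on the left of [e1] and [e3] multiply to [k], and so do those of [e2] and [e4]. [F]
   collects the differences common to both sides of the resulting identity. *)
pose k := c 0 ^+ 2 * c 1%N * c 2%N * c 3%N * a.
pose F := V x0 x1 x3 * V x1 x2 x4 * (x1 - x0) * (x4 - x0) * (x2 - x0).
apply/eqP; rewrite -subr_eq0; apply/eqP.
have kF0 : k * D ^+ 2 * F != 0.
  by rewrite /k /F /V !mulf_neq0 ?expf_neq0 ?c_neq0 ?rN.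
apply: (mulfI kF0); rewrite mulr0.
(* Each product pairs the left sides of two equations with the right sides of the other two, so the
   equations turn both into the same product. *)
transitivity (
  (c 0 * c 1%N * a * V x1 x2 x0) * (c 0 * c 2%N * c 3%N * V x1 x3 x4)
    * (D * V x0 x4 x2 * (D * V x0 x1 x3))
  - (c 0 * c 2%N * a * V x1 x0 x3) * (c 0 * c 1%N * c 3%N * V x1 x2 x4)
    * (D * V x0 x1 x4 * (D * V x0 x2 x3))).
  by rewrite /k /F /V; ring.
by rewrite e1 e2 e3 e4; ring.
Qed.
End ConicForm.

(** * From a digraph isomorphism to the action of [A] on the conic points *)

Section Labelling.
Set Implicit Arguments.
Unset Strict Implicit.
Context {R : realType} (t : nat -> R) (m : nat).
Hypothesis t_inj : injective t.
Let K := conic_cone t m.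
Let x i := conic_pt (t i).

Lemma Phi_pt_inj i j : (i < m)%N -> (j < m)%N ->
  Phi K (x i) = Phi K (x j) -> i = j.
Proof.
move=> im jm eij; apply: (@Phi_pt_sub _ t m t_inj j i 1) => //.
by rewrite scale1r -/K -/(x i) eij.
Qed.

(** Extreme representatives are positive multiples of conic points, and such scaling leaves [Phi]
    unchanged. *)
Lemma ray_arcP (A : 'M[R]_3) (E1 E2 : set_type (extreme_rays K)) k l :
  (k < m)%N -> (l < m)%N -> val E1 = Phi K (x k) -> val E2 = Phi K (x l) ->
  @Defs.arc (ray_digraph A K) E1 E2 <-> Phi K (x l) `<=` Phi K (A *m x k).
Proof.
move=> km lm E1k E2l; split=> [|kl]; last first.
  by exists (x k), (x l); split=> //; exact: extreme_pt.
move=> [u [v [/(extreme_vectorP) [i im [c c0 ->]] _ e1 e2]]].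
rewrite -E2l e2 -scalemxAr PhiZ //; move: e1; rewrite E1k PhiZ //.
by move=> /Phi_pt_inj -> //.
Qed.

(** In a nonnegative decomposition of an image, a missing arc kills the coefficient. The arcs that
    are present then force the surviving coefficients to be positive. *)
Lemma F1_labelling (A : 'M[R]_3) : (2 <= m)%N -> cone_preserving K A ->
  digraph_isomorphic (ray_digraph A K) (F1 m) ->
  exists s : nat -> nat, [/\ {in gtn m, forall i, (s i < m)%N},
    {in gtn m &, injective s},
    forall i, (i.+1 < m)%N -> exists2 c, 0 < c & A *m x (s i) = c *: x (s i.+1) &
    exists a b, [/\ 0 < a, 0 < b &
      A *m x (s m.-1) = a *: x (s 0%N) + b *: x (s 1%N)]].
Proof.
move=> m2 KA [f [g fK gK] f_arc].
have /choice [s gs] : forall i : 'I_m, exists j : 'I_m, val (g i) = Phi K (x j).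
  move=> i; have := valP (g i); rewrite inE.
  move: (val (g i)) => E; rewrite /K extreme_raysE // => -[j jm <-].
  by exists (Ordinal jm).
have s_inj : injective s.
  by move=> i j sij; apply: (can_inj gK); apply: val_inj; rewrite !gs sij.
have arcP i j : @Defs.arc (F1 m) i j <-> Phi K (x (s j)) `<=` Phi K (A *m x (s i)).
  rewrite -(ray_arcP A (ltn_ord _) (ltn_ord _) (gs i) (gs j)).
  by have := f_arc (g i) (g j); rewrite !gK => fa; split=> /fa.
(* The points may be linearly dependent, so [h] is merely some choice of coefficients; any choice
   serves. *)
have [h [h0 Ah]] : exists h : 'I_m -> 'I_m -> R, (forall i j, 0 <= h i j) /\
    forall i, A *m x (s i) = \sum_j h i j *: x (s j).
  have /choice [h hP] : forall i : 'I_m, exists h : 'I_m -> R, (forall j, 0 <= h j) /\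
      A *m x (s i) = \sum_j h j *: x (s j).
    move=> i; have [a a0 ->] := KA _ (conic_cone_pt t (ltn_ord (s i))).
    exists (a \o s); split=> [j|]; first exact: a0.
    by rewrite (reindex_inj s_inj).
  by exists h; split=> i; case: (hP i).
have h_arc i j : 0 < h i j -> @Defs.arc (F1 m) i j.
  move=> hij; apply/arcP; rewrite Ah; apply: Phi_sub.
  have := @Phi_summand _ t m (h i \o invF s_inj) (s j) _ _.
  rewrite (reindex_inj s_inj) /= invF_f; under eq_bigr do rewrite invF_f.
  by apply.
have hN i j : ~ @Defs.arc (F1 m) i j -> h i j = 0.
  by move=> /(contra_not (@h_arc i j)) /negP; rewrite -leNgt => h_le;
    apply/le_anti; rewrite h_le h0.
have arc_ray i j k c : @Defs.arc (F1 m) i j -> 0 <= c ->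
    A *m x (s i) = c *: x (s k) -> j = k.
  move=> /arcP + c0 e; rewrite e => /(Phi_pt_sub t_inj (ltn_ord _) (ltn_ord _) c0) e'.
  by apply: s_inj; apply: val_inj.
(* Extension of [s] to all naturals, with default 0 beyond the range. *)
pose s' i := if insub i is Some j then s j : nat else 0%N.
have s'E (i : 'I_m) : s' i = s i by rewrite /s' valK.
exists s'; split.
- by move=> i; rewrite inE => im; rewrite -[i]/(val (Ordinal im)) s'E.
- move=> i j; rewrite !inE => im jm.
  rewrite -[i]/(val (Ordinal im)) -[j]/(val (Ordinal jm)) !s'E => e.
  by congr val; apply: s_inj; apply: val_inj.
- move=> i i1m; have im := ltnW i1m; pose o := Ordinal im; pose o1 := Ordinal i1m.
  have eA : A *m x (s o) = h o o1 *: x (s o1).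
    rewrite Ah (bigD1 o1) //= big1 ?addr0 // => j /eqP jo1.
    rewrite hN ?scale0r // => -[] /=.
    + by move=> ji; apply: jo1; apply: val_inj.
    + by move=> [im' _]; move: (i1m); rewrite im' ltnn.
    + by move=> [im' _]; move: (i1m); rewrite im' ltnn.
  exists (h o o1); last by rewrite (s'E o) (s'E o1).
  (* A zero coefficient makes the image 0, a multiple of [x (s o)] as well, so the arc to [o1] would
     force [o1 = o]. *)
  rewrite lt_neqAle h0 andbT; apply/eqP => ho.
  have : o1 = o.
    apply: (@arc_ray o o1 o 0) => //; first by constructor 1.
    by rewrite eA -ho !scale0r.
  by move/(congr1 val) => /= /eqP; rewrite eqn_leq ltnn.
- have m0 := ltnW m2; have mm : (m.-1 < m)%N by rewrite prednK.
  pose o := Ordinal mm; pose o0 := Ordinal m0; pose o1 := Ordinal m2.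
  have o01 : o1 != o0 by [].
  have eA : A *m x (s o) = h o o0 *: x (s o0) + h o o1 *: x (s o1).
    rewrite Ah (bigD1 o0) // (bigD1 o1) //= big1 ?addr0 // => j /andP [/eqP jo0 /eqP jo1].
    rewrite hN ?scale0r // => -[] /=.
    + by rewrite prednK // => jm; have := ltn_ord j; rewrite jm ltnn.
    + by move=> [_ j0]; apply: jo0; apply: val_inj.
    + by move=> [_ j1]; apply: jo1; apply: val_inj.
  exists (h o o0), (h o o1); split; last by rewrite (s'E o) (s'E o0) (s'E o1).
  (* Without this coefficient the image lies on the ray of [o1], contradicting the arc to [o0]. *)
  + rewrite lt_neqAle h0 andbT; apply/eqP => ho; have : o0 = o1.
      apply: (@arc_ray o o0 o1 (h o o1)) => //; last by rewrite eA -ho scale0r add0r.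
      by constructor 2; rewrite /= prednK.
    by move/(congr1 val).
  + rewrite lt_neqAle h0 andbT; apply/eqP => ho; have : o1 = o0.
      apply: (@arc_ray o o1 o0 (h o o0)) => //; last by rewrite eA -ho scale0r addr0.
      by constructor 3; rewrite /= prednK.
    by move/(congr1 val).
Qed.

End Labelling.

(** * Integer check of the five-point relation *)

Lemma squares_condition (k0 k1 k2 k3 k4 : nat) :
  all (fun k => k < 5)%N [:: k0; k1; k2; k3; k4] -> uniq [:: k0; k1; k2; k3; k4] ->
  let q (k : nat) : int := k%:R ^+ 2 in
  (q k2 - q k0) * (q k3 - q k1) * (q k3 - q k4)
    != (q k4 - q k1) * (q k3 - q k0) * (q k2 - q k3).
Proof.
pose q (k : nat) : int := k%:R ^+ 2.
(* Exhaustive search over quintuples; working in [int] makes the test computable. *)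
have : all (fun a => all (fun b => all (fun c => all (fun d => all (fun e =>
    uniq [:: a; b; c; d; e] ==>
    ((q c - q a) * (q d - q b) * (q d - q e)
      != (q e - q b) * (q d - q a) * (q c - q d)))
  (iota 0 5)) (iota 0 5)) (iota 0 5)) (iota 0 5)) (iota 0 5) by vm_compute.
move=> H /= /and5P [l0 l1 l2 l3 /andP [l4 _]] u.
have I k : (k < 5)%N -> k \in iota 0 5 by rewrite mem_iota.
move: H => /allP /(_ _ (I _ l0)) /allP /(_ _ (I _ l1)) /allP /(_ _ (I _ l2)).
by move=> /allP /(_ _ (I _ l3)) /allP /(_ _ (I _ l4)) /implyP /(_ u).
Qed.

(** * The contradiction, for [m = 5] and for larger [m] *)

Theorem theorem6p5 (R : realType) (m : nat) (hm : (5 <= m)%N) :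
  exists K : set 'cV[R]_3,
    [/\ polyhedral_cone K, (extreme_rays K #= `I_m)%card &
      ~ exists A : 'M[R]_3,
          K_primitive K A /\ digraph_isomorphic (ray_digraph A K) (F1 m)].
Proof.
(* The values matter for [m = 5]; for larger [m] it is their distinctness that counts. *)
pose t (i : nat) : R := i%:R ^+ 2.
have t_inj : injective t.
  by move=> i j /eqP; rewrite /t eqrXn2 ?ler0n // eqr_nat => /eqP.
exists (conic_cone t m); split.
- by apply: conic_cone_polyhedral => //; apply: leq_trans hm.
- exact: extreme_rays_card.
move=> [A [[KA _] isoA]].
have [|s [s_lt s_inj As [a [b [a0 b0 Am]]]]] := F1_labelling t_inj _ KA isoA.
  exact: leq_trans hm.
pose r i := t (s i).
have r_inj : {in gtn m &, injective r}.
  by move=> i j im jm /t_inj /(s_inj _ _ im jm).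
have m0 : (0 < m)%N by exact: leq_trans hm.
(* For [m = 5] only four zeros are available, one too few for a quartic. *)
have [m5|m5] := eqVneq m 5.
  have /choice [c cP] : forall i, exists c, (i.+1 < m)%N ->
      0 < c /\ A *m conic_pt (r i) = c *: conic_pt (r i.+1).
    move=> i; case: (ltnP i.+1 m) => [/As [c c0 e]|_]; last by exists 0.
    by exists c.
  rewrite m5 in s_lt s_inj r_inj cP Am.
  have c0 i : (i < 4)%N -> c i != 0 by move=> /cP [/lt0r_neq0].
  have pent := pentagon_condition r_inj (fun i i4 => (cP i i4).2) c0 (lt0r_neq0 a0) Am.
  have [||] := elimN eqP (@squares_condition (s 0%N) (s 1%N) (s 2%N) (s 3%N) (s 4%N) _ _).
  - by rewrite /= !s_lt.
  - by rewrite -[[:: _; _; _; _; _]]/(map s (iota 0 5)) map_inj_in_uniq ?iota_uniq //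
      => i j; rewrite !mem_iota; exact: s_inj.
  have tq k : t k = (k%:R ^+ 2 : int)%:~R by rewrite /t rmorphXn /= rmorph_nat.
  by move: pent; rewrite /r !tq -!rmorphB -!rmorphM => /intr_inj.
have m6 : (5 < m)%N by rewrite ltn_neqAle eq_sym m5.
have r_lt i : i \in iota 0 m.-1 -> (i.+1 < m)%N.
  by rewrite mem_iota add0n /= => i_lt; rewrite -(prednK m0).
(* The [m.-1] zeros, at least five, force the pulled-back form to vanish at the last parameter
   too. *)
have := @conic_form_mulmx_eq0 _ A [seq r i | i <- iota 0 m.-1] (r m.-1).
rewrite Am conic_form_chord size_map size_iota -ltnS prednK // => q0.
suff : a * b * (t (s 0%N) - t (s 1%N)) ^+ 2 != 0.
  case/eqP; apply: q0 => //.
    rewrite map_inj_in_uniq ?iota_uniq // => i j /r_lt /ltnW im /r_lt /ltnW jm.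
    exact: r_inj.
  move=> _ /mapP [i /r_lt /As [c _ Ai] ->].
  (* A multiple of a conic point is treated as a chord with second weight 0. *)
  by rewrite Ai -[_ *: _]addr0 -(scale0r (conic_pt 0)) conic_form_chord mulr0 mul0r.
have m1 : (1 < m)%N by exact: leq_trans hm.
apply: mulf_neq0; first by rewrite mulf_neq0 ?(lt0r_neq0 a0) ?(lt0r_neq0 b0).
by rewrite expf_neq0 // subr_eq0; apply/eqP => /(r_inj _ _ m0 m1).
Qed.
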